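(* Let $H$ be a finite-dimensional real Hilbert space and let $A:H\to H$ be a linear operator with $A=-A^*$. Consider the Crank-Nicolson scheme with step $\tau>0$ $$\frac{y^{n+1}-y^n}{\tau}+A\,\frac{y^{n+1}+y^n}{2}=0,\qquad n=0,1,\dots,N-1,\qquad y^0=u^0\in H.$$ Then the scheme provides a time-reversible computational algorithm and is unconditionally stable in $H$, i.e. for every $\tau>0$ one has $\|y^{n+1}\|\le\|y^n\|$, $n=0,1,\dots,N-1$, for all $u^0\in H$. Moreover, the scheme is conservative, $$\|y^{n+1}\|=\|y^n\|,\qquad n=0,1,\dots,N-1,$$ and multiconservative: for every constant linear operator $B:H\to H$ with $BA=AB$, $$\|By^{n+1}\|=\|By^n\|,\qquad n=0,1,\dots,N-1.$$
   Context: The scheme approximates in time the Cauchy problem $\frac{du}{dt}+Au=0$, $u(0)=u^0$, where $A$ is a constant (time-independent) skew-symmetric operator (a discrete advection operator, linear in the transport velocity). ''Constant'' for an operator means independent of time. The algorithm is time-reversible if, whenever $y^{n+1}$ is computed from $y^n$ by one step of the scheme and then the transport velocity is changed to the opposite (so that $A$ is replaced by $-A$), the next step of the scheme, started from $y^{n+1}$, yields a solution that coincides with $y^n$. Here it is understood that each step of the scheme determines $y^{n+1}$ uniquely from $y^n$. *)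

(* Defs.v *)
From HB Require Import structures.
From mathcomp Require Import all_boot all_order all_algebra.
From mathcomp Require Import classical_sets reals.

Set Implicit Arguments.
Unset Strict Implicit.
Unset Printing Implicit Defensive.
Import Order.TTheory GRing.Theory Num.Theory.
Local Open Scope ring_scope.

(* A finite-dimensional real Hilbert space is a [vectType] over the reals
   together with a positive definite symmetric bilinear form; completeness is
   automatic in finite dimension. *)
Section Hilbert.
Variables (R : realType) (H : vectType R) (form : {dot H for idfun}).

Definition hnorm (x : H) : R := Num.sqrt (form x x).

Definition is_adjoint (A B : 'End(H)) : Prop :=
  forall x y, form (A x) y = form x (B y).

(* The default value 0 is never used: see [adjointP] and [adjoint_uniq]. *)
Definition adjoint (A : 'End(H)) : 'End(H) :=
  xget 0 [set B | is_adjoint A B]%classic.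

Lemma form_eq0 (y : H) : form y y = 0 -> y = 0.
Proof.
move=> fy; apply/eqP; apply: contraT => /(neq0_dnorm_gt0 (s := form)).
by rewrite fy ltxx.
Qed.

Let n := \dim {:H}.
Let e (i : 'I_n) : H := (vbasis {:H})`_i.
Let rho_fun (y : H) : 'rV[R]_n := \row_i form (e i) y.

Let rho_is_linear : linear rho_fun.
Proof. by move=> a u v; apply/rowP => i; rewrite !mxE linearPr. Qed.
Let rho : {linear H -> 'rV[R]_n} :=
  HB.pack rho_fun (GRing.isLinear.Build R H 'rV[R]_n *:%R rho_fun rho_is_linear).

Let span_e (x : H) : x = \sum_i coord (vbasis {:H}) i x *: e i.
Proof. exact: coord_vbasis (memvf x). Qed.

Let rho_inj : lker (linfun rho) == 0%VS.
Proof.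
rewrite -subv0; apply/subvP => y; rewrite memv_ker lfunE /= memv0 => /eqP r0.
apply/eqP/form_eq0; rewrite {1}(span_e y) linear_sumlz big1 // => i _.
by rewrite linearZl_LR; move/rowP/(_ i): r0; rewrite !mxE /= => ->; rewrite mulr0.
Qed.

Let rho_surj (v : 'rV[R]_n) : rho ((linfun rho)^-1%VF v) = v.
Proof.
have imf : limg (linfun rho) = fullv.
  apply/eqP; rewrite eqEdim subvf /= limg_dim_eq ?(eqP rho_inj) ?capv0 //.
  by rewrite dimvf /dim /= mul1n.
by rewrite -[LHS](lfunE rho) limg_lfunVK // imf memvf.
Qed.

Lemma adjoint_exists (A : 'End(H)) : exists B, is_adjoint A B.
Proof.
pose g (y : H) : 'rV[R]_n := \row_i form (A (e i)) y.
have g_lin : linear g.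
  by move=> a u v; apply/rowP => i; rewrite !mxE linearPr.
pose gL := GRing.isLinear.Build R H 'rV[R]_n *:%R g g_lin.
pose gl : {linear H -> 'rV[R]_n} := HB.pack g gL.
exists ((linfun rho)^-1 \o linfun gl)%VF => x y.
rewrite comp_lfunE [linfun gl y]lfunE /=.
set z := (_^-1%VF _); have hz : rho z = g y by rewrite /z rho_surj.
rewrite (span_e x) linear_sum !linear_sumlz; apply: eq_bigr => i _.
rewrite linearZ !linearZl_LR; congr (_ * _).
by move/rowP/(_ i): hz; rewrite !mxE.
Qed.

Lemma adjointP (A : 'End(H)) : is_adjoint A (adjoint A).
Proof.
by rewrite /adjoint; case: xgetP => // noB; have [B /noB] := adjoint_exists A.
Qed.

Lemma adjoint_uniq (A B : 'End(H)) : is_adjoint A B -> B = adjoint A.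
Proof.
move=> hB; apply/lfunP => y; apply/eqP; rewrite -subr_eq0; apply/eqP.
apply: form_eq0; rewrite linearBr; apply/eqP; rewrite subr_eq0; apply/eqP.
exact: etrans (esym (hB _ _)) (adjointP A _ _).
Qed.

End Hilbert.

Section TwoLevelSchemes.
Variables (R : realType) (H : vectType R).

(* A two-level scheme is the relation "y' is obtained from y in one step". *)
Definition well_posed (S : H -> H -> Prop) : Prop :=
  forall y, exists! y', S y y'.

Definition solution (S : H -> H -> Prop) (N : nat) (u0 : H) (y : nat -> H) :
    Prop :=
  y 0%N = u0 /\ forall n, (n < N)%N -> S (y n) (y n.+1).

(* Here the scheme is parametrised by the operator of the problem; reversing
   the transport velocity replaces A by - A. *)
Definition time_reversible (S : 'End(H) -> H -> H -> Prop) (A : 'End(H)) :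
    Prop :=
  [/\ well_posed (S A), well_posed (S (- A))
    & forall y y' z, S A y y' -> S (- A) y' z -> z = y].

Variable form : {dot H for idfun}.

(* Here the scheme is parametrised by the time step. *)
Definition unconditionally_stable (S : R -> H -> H -> Prop) : Prop :=
  forall tau, 0 < tau -> forall N u0 y, solution (S tau) N u0 y ->
  forall n, (n < N)%N -> hnorm form (y n.+1) <= hnorm form (y n).

Definition conservative (S : H -> H -> Prop) : Prop :=
  forall N u0 y, solution S N u0 y ->
  forall n, (n < N)%N -> hnorm form (y n.+1) = hnorm form (y n).

Definition multiconservative (A : 'End(H)) (S : H -> H -> Prop) : Prop :=
  forall B : 'End(H), (B \o A)%VF = (A \o B)%VF ->
  forall N u0 y, solution S N u0 y ->
  forall n, (n < N)%N -> hnorm form (B (y n.+1)) = hnorm form (B (y n)).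

Definition crank_nicolson (tau : R) (A : 'End(H)) (y y' : H) : Prop :=
  tau^-1 *: (y' - y) + A (2^-1 *: (y' + y)) = 0.

End TwoLevelSchemes.

(* Main.v *)
(* Since A is skew, x and A x are orthogonal. Pairing the scheme with
   y' + y therefore gives |y'|^2 = |y|^2, and pairing the homogeneous equation
   x + c A x = 0 with x gives x = 0; hence 1 + c A is injective, so bijective,
   and the midpoint (y' + y) / 2 is determined by (1 + (tau / 2) A) m = y.
   The relation of one step is invariant under exchanging y and y' together
   with the sign of A, so reversibility is uniqueness for - A; and it is
   invariant under any B commuting with A, which gives multiconservativity. *)
Require Import Defs.
From mathcomp Require Import all_boot all_order all_algebra.
From mathcomp Require Import classical_sets reals.
Import Order.TTheory GRing.Theory Num.Theory.
Local Open Scope ring_scope.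

Lemma dot_sym (R : realType) (H : vectType R) (form : {dot H for idfun})
    (x y : H) : form x y = form y x.
Proof. by rewrite hermC /= expr0 mul1r. Qed.

(** Moving [A] across the symmetric real form changes the sign, so the value equals its own
    opposite. *)
Lemma skew_form0 (R : realType) (H : vectType R) (form : {dot H for idfun})
    (A : 'End(H)) (hA : A = - adjoint form A) (x : H) : form (A x) x = 0.
Proof.
have h : form (A x) x = - form (A x) x.
  rewrite {1}(adjointP form A x x).
  have -> : adjoint form A = - A by rewrite {2}hA opprK.
  by rewrite opp_lfunE linearNr /= dot_sym.
by apply/eqP; move/eqP: h; rewrite -addr_eq0 -mulr2n mulrn_eq0.
Qed.

Lemma skew_shift_eq0 (R : realType) (H : vectType R)
    (form : {dot H for idfun}) (A : 'End(H))
    (A0 : forall x, form (A x) x = 0) (c : R) (x : H) :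
  x + c *: A x = 0 -> x = 0.
Proof.
move=> hx; apply: (@form_eq0 _ _ form).
have : form (x + c *: A x) x = 0 by rewrite hx linear0l.
by rewrite linearDl linearZl_LR /= A0 mulr0 addr0.
Qed.

Lemma skew_shift_surj (R : realType) (H : vectType R)
    (form : {dot H for idfun}) (A : 'End(H))
    (A0 : forall x, form (A x) x = 0) (c : R) (y : H) :
  exists x, x + c *: A x = y.
Proof.
pose f : 'End(H) := (\1 + c *: A)%VF.
have fE x : f x = x + c *: A x by rewrite add_lfunE id_lfunE scale_lfunE.
have kf : lker f == 0%VS.
  rewrite -subv0; apply/subvP => x; rewrite memv_ker memv0 fE => /eqP fx.
  exact/eqP/(skew_shift_eq0 _ _ _ _ A0 _ _ fx).
by exists (f^-1%VF y); rewrite -fE lker0_lfunVK.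
Qed.

(** In this form the left side is odd and the right side even under exchanging [y] and [y'], so the
    exchange amounts to a change of sign of [A]. *)
Lemma crank_nicolsonE (R : realType) (H : vectType R) (tau : R) (A : 'End(H))
    (y y' : H) : tau != 0 ->
  crank_nicolson tau A y y' <-> y' - y = - ((tau / 2) *: A (y' + y)).
Proof.
move=> tau0; rewrite /crank_nicolson linearZ /=.
have -> : tau^-1 *: (y' - y) + 2^-1 *: A (y' + y)
    = tau^-1 *: (y' - y + (tau / 2) *: A (y' + y)).
  by rewrite [RHS]scalerDr scalerA mulrA mulVf // mul1r.
split=> [/eqP|->]; last by rewrite addNr scaler0.
by rewrite scaler_eq0 invr_eq0 (negPf tau0) /= addr_eq0 => /eqP.
Qed.

Lemma crank_nicolson_rev (R : realType) (H : vectType R) (tau : R)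
    (A : 'End(H)) (y y' : H) : tau != 0 ->
  crank_nicolson tau A y y' -> crank_nicolson tau (- A) y' y.
Proof.
move=> tau0 /crank_nicolsonE - /(_ tau0) h; apply/crank_nicolsonE => //.
by rewrite -opprB h opp_lfunE scalerN addrC.
Qed.

Lemma crank_nicolson_comm (R : realType) (H : vectType R) (tau : R)
    (A B : 'End(H)) (y y' : H) : (B \o A)%VF = (A \o B)%VF ->
  crank_nicolson tau A y y' -> crank_nicolson tau A (B y) (B y').
Proof.
move=> BA h; rewrite /crank_nicolson -linearB -linearD -!linearZ /=.
by rewrite -(comp_lfunE A) -BA comp_lfunE -linearD h linear0.
Qed.

Lemma crank_nicolson_well_posed (R : realType) (H : vectType R)
    (form : {dot H for idfun}) (A : 'End(H))
    (A0 : forall x, form (A x) x = 0) (tau : R) :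
  tau != 0 -> well_posed (crank_nicolson tau A).
Proof.
move=> tau0 y; have [m mE] := skew_shift_surj _ _ _ _ A0 (tau / 2) y.
have y'y : m *+ 2 - y + y = m *+ 2 by rewrite subrK.
have cA2 : (tau / 2) *: A (m *+ 2) = (tau / 2) *: A m *+ 2.
  by rewrite !mulr2n linearD scalerDr.
(* The vector [m] is the midpoint of the step, which forces [y' = 2 m - y]. *)
exists (m *+ 2 - y); split.
  apply/crank_nicolsonE => //; rewrite y'y cA2 -{1 2}mE.
  by rewrite -addrA -opprD -mulr2n mulrnDl opprD addrA subrr add0r.
move=> z /crank_nicolsonE - /(_ tau0) hz.
apply/eqP; rewrite subr_eq; apply/eqP/esym.
(* Twice the gap between the midpoint given by [z] and [m] solves the homogeneous equation, hence
   vanishes. *)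
have d0 : (z + y - m *+ 2) + (tau / 2) *: A (z + y - m *+ 2) = 0.
  rewrite linearB scalerBr /= cA2 -[_ *: A (z + y)]opprK -hz.
  rewrite opprB addrACA -opprD -mulrnDl mE [z + y]addrC.
  by rewrite [y - z]addrC addrA addrK -mulr2n subrr.
by apply/eqP; rewrite -subr_eq0; apply/eqP/(skew_shift_eq0 _ _ _ _ A0 _ _ d0).
Qed.

Lemma crank_nicolson_hnorm (R : realType) (H : vectType R)
    (form : {dot H for idfun}) (A : 'End(H))
    (A0 : forall x, form (A x) x = 0) (tau : R) (y y' : H) :
  tau != 0 -> crank_nicolson tau A y y' -> hnorm form y' = hnorm form y.
Proof.
move=> tau0 /crank_nicolsonE - /(_ tau0) h; congr Num.sqrt.
have : form (y' - y) (y' + y) = 0.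
  by rewrite h linearNl /= linearZl_LR /= A0 mulr0 oppr0.
(* By symmetry the cross terms cancel, leaving the difference of the squared norms. *)
rewrite linearBl /= !linearDr /= [form y y']dot_sym opprD addrA.
by rewrite addrK => /eqP; rewrite subr_eq0 => /eqP.
Qed.

Theorem theorem5 (R : realType) (H : vectType R) (form : {dot H for idfun})
    (A : 'End(H)) (hA : A = - adjoint form A) :
  [/\ forall tau : R, 0 < tau -> time_reversible (crank_nicolson tau) A,
      unconditionally_stable form (fun tau => crank_nicolson tau A),
      forall tau : R, 0 < tau -> conservative form (crank_nicolson tau A)
    & forall tau : R, 0 < tau ->
        multiconservative form A (crank_nicolson tau A)].
Proof.
have A0 := skew_form0 _ _ _ _ hA.
(* The reversed scheme must be well posed too, so orthogonality is also needed for [- A]. *)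
have NA0 x : form ((- A) x) x = 0 by rewrite opp_lfunE linearNl /= A0 oppr0.
have mcons tau : 0 < tau -> multiconservative form A (crank_nicolson tau A).
  move=> /lt0r_neq0 tau0 B BA N u0 y [_ sy] n /sy hn.
  apply: crank_nicolson_hnorm A0 _ _ _ tau0 _.
  exact: crank_nicolson_comm BA hn.
have cons tau : 0 < tau -> conservative form (crank_nicolson tau A).
  move=> /lt0r_neq0 tau0 N u0 y [_ sy] n /sy.
  exact: crank_nicolson_hnorm.
split=> // [tau /lt0r_neq0 tau0|tau tau0 N u0 y sy n nN].
  have wpN := crank_nicolson_well_posed _ _ _ _ NA0 _ tau0.
  split=> //; first exact: crank_nicolson_well_posed A0 _ tau0.
  (* Both [y] and [z] are now successors of [y'] under the scheme for [- A]. *)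
  move=> y y' z /(crank_nicolson_rev _ _ _ _ _ _ tau0) hy hz.
  by have [w [_ uw]] := wpN y'; rewrite -(uw _ hz) (uw _ hy).
by rewrite (cons _ tau0 _ _ _ sy _ nN).
Qed.
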